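(* Let $(U_i,V_i)_{i\in\mathbb Z}$ be a stationary sequence of pairs of real random variables with $U_i\ge0$ almost surely. Let $0<p<q$ and assume that, for some constant $c$, $\|U_iV_i\|_r\le c$ for $r=\frac{pq}{q-p}$ and $\|V_i\|_s\le c$ for $s=\frac{p(q+2)}{q-p}$. If the dependence of the sequence $(U_i,V_i)_{i\in\mathbb Z}$ is such that, for some constant $C$ and all $n$, $$\|\widehat D_n-D\|_q\le Cn^{-1/2},\qquad \|\widehat N_n-N\|_p\le Cn^{-1/2},$$ then $\|\widehat R_n-R\|_p=\mathcal O(n^{-1/2})$ as $n\to\infty$.
   Context: $\widehat D_n=\frac1n\sum_{i=1}^nU_i$, $\widehat N_n=\frac1n\sum_{i=1}^nU_iV_i$, $D=\mathbb EU_1>0$, $N=\mathbb EU_1V_1$, $\widehat R_n=\widehat N_n/\widehat D_n$ (with the convention $0/0=0$), $R=N/D$. $\|Z\|_p=(\mathbb E|Z|^p)^{1/p}$. *)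

(* Defs.v *)
From HB Require Import structures.
From mathcomp Require Import all_boot all_order all_algebra.
From mathcomp Require Import all_classical all_reals all_analysis.

Set Implicit Arguments.
Unset Strict Implicit.
Unset Printing Implicit Defensive.
Import Order.TTheory GRing.Theory Num.Theory.
Import numFieldNormedType.Exports.

Local Open Scope classical_set_scope.
Local Open Scope ring_scope.

(* Strict stationarity of a process indexed by the integers: its
   finite-dimensional laws are invariant under translation of time. The X i are
   meant to be measurable. *)
Definition stationary (d d' : measure_display) (T : measurableType d)
    (T' : measurableType d') (R : realType) (P : probability T R)
    (X : int -> T -> T') : Prop :=
  forall (n : nat) (t : n.-tuple int) (h : int) (B : set (n.-tuple T')),
    measurable B ->
    P [set w | B [tuple X (tnth t k + h) w | k < n]] =
    P [set w | B [tuple X (tnth t k) w | k < n]].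

Definition Dhat (d : measure_display) (T : measurableType d) (R : realType)
    (P : probability T R) (U : int -> {RV P >-> R}) (n : nat) (w : T) : R :=
  n%:R^-1 * \sum_(1 <= i < n.+1) U i%:Z w.

Definition Nhat (d : measure_display) (T : measurableType d) (R : realType)
    (P : probability T R) (U V : int -> {RV P >-> R}) (n : nat) (w : T) : R :=
  n%:R^-1 * \sum_(1 <= i < n.+1) (U i%:Z w * V i%:Z w).

(* Division by 0 gives 0 in a field, which is the convention 0 / 0 = 0: if the
   U i are nonnegative, Dhat = 0 forces Nhat = 0. *)
Definition Rhat (d : measure_display) (T : measurableType d) (R : realType)
    (P : probability T R) (U V : int -> {RV P >-> R}) (n : nat) (w : T) : R :=
  Nhat U V n w / Dhat U n w.

(* The moment (E |Z| ^ p) ^ (1 / p) of a real random variable, in [0, +oo];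
   used for every p > 0, so it need not be a norm. *)
Definition pnorm (d : measure_display) (T : measurableType d) (R : realType)
    (P : probability T R) (p : R) (Z : T -> R) : \bar R :=
  'N[P]_(p%:E) [EFin \o Z].

(* Main.v *)
Require Import Defs.
From HB Require Import structures.
From mathcomp Require Import all_boot all_order all_algebra.
From mathcomp Require Import all_classical all_reals all_analysis.
From mathcomp Require Import measurable_realfun.
From mathcomp Require Import ring lra.

Set Implicit Arguments.
Unset Strict Implicit.
Unset Printing Implicit Defensive.
Import Order.TTheory GRing.Theory Num.Theory.
Import numFieldNormedType.Exports.

Local Open Scope classical_set_scope.
Local Open Scope ring_scope.

(** Write d = Dhat, m = Nhat, rho = m / d and Delta = d - D. Where d is nonzero,
    and also where m = d = 0,

      rho - N / D = D^-1 (m - N) - D^-1 rho Delta,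

    so the first term has the right order by assumption and everything rests on
    the product rho Delta. The difficulty is that d may come close to 0. Two
    bounds of rho are available:

    - where |Delta| <= D / 2 the denominator is at least D / 2, hence
      |rho| <= (2 / D) |m|;
    - almost surely rho is an average of V_1, ..., V_n with nonnegative weights
      U_i, hence |rho| <= M := (sum_i |V_i|^s)^(1/s), whatever d is.

    The second one is used only where |Delta| > D / 2, and there a factor
    ((2 / D) |Delta|)^t, at least 1, can be inserted for any t >= 0. This gives
    the pointwise inequality of [ratio_bound]:

      |rho - N / D| <= D^-1 |m - N| + 2 D^-2 |m| |Delta|
                       + D^-1 (2 / D)^t M |Delta|^(1 + t).

    Since 1/p = 1/r + 1/q, Hoelder's inequality bounds the second term by the
    product of the r-th moment of m, which is bounded, and of the q-th moment of
    Delta, which is O(n^(-1/2)).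

    For the third term the choice is t = 2 / s. On the one hand
    1/p = 1/s + (1 + t)/q, so Hoelder's inequality applies with the s-th moment
    of M and the q-th moment of Delta. On the other hand the s-th moment of M is
    O(n^(1/s)), while that of |Delta|^(1 + t) is O(n^(-1/2 - t/2)) =
    O(n^(-1/2 - 1/s)): the loss from replacing an average of the V_i by M is
    exactly compensated.

    None of the exponents p, q, r, s is assumed to be at least 1. Below 1 the
    triangle inequality only holds up to a constant ([pnorm_add]), which is
    harmless for a sum of three terms but not for a sum of n terms. So when
    r < 1 the moments of m are bounded by its first absolute moment, which is
    finite because the expectation N of U_1 V_1 is, and because of stationarity
    ([Nhat_bounded]). *)

(** * Moments of arbitrary positive order *)

Section pnorm_theory.
Context (d : measure_display) (T : measurableType d) (R : realType).
Context (P : probability T R).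
Implicit Types (p q r a b t : R) (f g : T -> R).

Lemma pnormE p f :
  pnorm P p f = ((\int[P]_w (`|f w| `^ p)%:E) `^ p^-1)%E.
Proof. by rewrite /pnorm unlock. Qed.

Lemma moment_ge0 p f : (0 <= \int[P]_w (`|f w| `^ p)%:E)%E.
Proof. by apply: integral_ge0 => w _; rewrite lee_fin powR_ge0. Qed.

Lemma measurable_moment p f : measurable_fun setT f ->
  measurable_fun setT (EFin \o (fun w => `|f w| `^ p)).
Proof.
move=> mf; apply/measurable_EFinP.
apply: (measurableT_comp (measurable_powR p)) => //.
exact: measurableT_comp.
Qed.

Lemma measurable_powR_norm p f : measurable_fun setT f ->
  measurable_fun setT (fun w => `|f w| `^ p).
Proof. by move=> /(measurable_moment p)/measurable_EFinP. Qed.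

(** Raising to the powers p and 1/p passes between a bound of the moment and a
    bound of the integral of |f|^p. All estimates below are stated with a real
    upper bound a, so that finiteness is carried along. *)
Lemma pnorm_leP p f a : 0 < p -> 0 <= a ->
  (pnorm P p f <= a%:E)%E <-> (\int[P]_w (`|f w| `^ p)%:E <= (a `^ p)%:E)%E.
Proof.
move=> p0 a0; rewrite pnormE; have := moment_ge0 p f.
set I := integral _ _ _ => I0.
have p1 : 0 <= p^-1 by rewrite invr_ge0 ltW.
have pK x : (0 <= x)%E -> ((x `^ p^-1) `^ p = x)%E.
  by move=> x0; rewrite -poweRrM mulVf ?gt_eqF// poweRe1.
have aK : ((a `^ p)%:E `^ p^-1 = a%:E)%E.
  by rewrite poweR_EFin -powRrM divff ?gt_eqF// powRr1.
split=> H.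
- rewrite -(pK I I0) -poweR_EFin; apply: gt0_ler_poweR => //.
  + exact: ltW.
  + by rewrite in_itv/= leey poweR_ge0.
  + by rewrite in_itv/= leey lee_fin a0.
- rewrite -aK; apply: gt0_ler_poweR => //.
  + by rewrite in_itv/= leey I0.
  + by rewrite in_itv/= leey lee_fin powR_ge0.
Qed.

Lemma pnorm_le_moment p f a : 0 < p -> 0 <= a -> (pnorm P p f <= a%:E)%E ->
  (\int[P]_w (`|f w| `^ p)%:E <= (a `^ p)%:E)%E.
Proof. by move=> p0 a0 /(pnorm_leP _ p0 a0). Qed.

Lemma pnorm_le_ge0 p f a : (pnorm P p f <= a%:E)%E -> 0 <= a.
Proof. by rewrite -lee_fin; apply: le_trans; exact: Lnorm_ge0. Qed.

Lemma le_pnorm p f g a : 0 < p ->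
  measurable_fun setT f -> measurable_fun setT g ->
  {ae P, forall w, `|f w| <= `|g w|} ->
  (pnorm P p g <= a%:E)%E -> (pnorm P p f <= a%:E)%E.
Proof.
move=> p0 mf mg fg ga; have a0 := pnorm_le_ge0 ga.
move: ga => /(pnorm_le_moment p0 a0) ga; apply/pnorm_leP => //.
apply: le_trans ga; apply: ae_ge0_le_integral => //.
- exact: measurable_moment.
- exact: measurable_moment.
apply: filterS fg => w fgw _; rewrite lee_fin.
by apply: ge0_ler_powR; rewrite ?nnegrE ?(ltW p0).
Qed.

Lemma pnorm_normr p (f : T -> R) : pnorm P p (fun w => `|f w|) = pnorm P p f.
Proof. by rewrite !pnormE; under eq_integral do rewrite normr_id. Qed.

Lemma pnorm_cst p (k : R) : 0 < p -> (pnorm P p (fun=> k) <= `|k|%:E)%E.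
Proof.
move=> p0; apply/pnorm_leP => //.
by rewrite integral_cst// [X in (_ * X)%E]probability_setT mule1.
Qed.

Lemma pnorm_scale p f (k : R) a : 0 < p -> measurable_fun setT f -> 0 <= k ->
  (pnorm P p f <= a%:E)%E -> (pnorm P p (fun w => k * f w)%R <= (k * a)%:E)%E.
Proof.
move=> p0 mf k0 fa; have a0 := pnorm_le_ge0 fa.
move: fa => /(pnorm_le_moment p0 a0) fa; apply/pnorm_leP; rewrite ?mulr_ge0//.
under eq_integral do rewrite normrM (ger0_norm k0) powRM// EFinM.
rewrite ge0_integralZl//.
- rewrite powRM// EFinM; apply: lee_pmul => //.
  + by rewrite lee_fin powR_ge0.
  + exact: moment_ge0.
- exact: measurable_moment.
- by rewrite lee_fin powR_ge0.
Qed.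

Lemma powR_add_le p (x y : R) : 0 < p -> 0 <= x -> 0 <= y ->
  (x + y) `^ p <= 2 `^ p * (x `^ p + y `^ p).
Proof.
move=> p0; wlog xy : x y / x <= y => [H x0 y0|x0 y0].
  by have [/H|/ltW/H] := leP x y; [exact|rewrite addrC [X in _ * X]addrC; exact].
apply: (@le_trans _ _ ((2 * y) `^ p)).
  apply: ge0_ler_powR; rewrite ?nnegrE ?(ltW p0) ?addr_ge0 ?mulr_ge0//.
  by rewrite mulr_natl mulr2n lerD2r.
by rewrite powRM// ler_wpM2l ?powR_ge0// lerDr powR_ge0.
Qed.

(** A constant for the triangle inequality of order p, valid for every p > 0: the
    factor 2 comes from (x + y)^p <= 2^p (x^p + y^p), the factor 2^(1/p) from
    a^p + b^p <= 2 (a + b)^p. *)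
Definition quasi_triangle p : R := 2 * 2 `^ p^-1.

Lemma quasi_triangle_ge0 p : 0 <= quasi_triangle p.
Proof. by rewrite mulr_ge0 ?powR_ge0. Qed.

Lemma pnorm_add p f g a b : 0 < p ->
  measurable_fun setT f -> measurable_fun setT g ->
  (pnorm P p f <= a%:E)%E -> (pnorm P p g <= b%:E)%E ->
  (pnorm P p (fun w => f w + g w)%R <= (quasi_triangle p * (a + b))%:E)%E.
Proof.
move=> p0 mf mg fa gb; have a0 := pnorm_le_ge0 fa; have b0 := pnorm_le_ge0 gb.
move: fa gb => /(pnorm_le_moment p0 a0) fa /(pnorm_le_moment p0 b0) gb.
apply/pnorm_leP => //; first by rewrite mulr_ge0 ?quasi_triangle_ge0 ?addr_ge0.
have mp (h : T -> R) : measurable_fun setT h ->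
    measurable_fun setT (EFin \o (fun w => `|h w| `^ p)).
  exact: measurable_moment.
have p2 w (h : T -> R) : (0 <= (`|h w| `^ p)%:E :> \bar R)%E by rewrite lee_fin powR_ge0.
apply: (@le_trans _ _ (\int[P]_w ((2 `^ p)%:E * ((`|f w| `^ p)%:E + (`|g w| `^ p)%:E)))%E).
  apply: ge0_le_integral => //.
  - by apply: mp; exact: measurable_funD.
  - by apply: emeasurable_funM => //; apply: emeasurable_funD; exact: mp.
  move=> w _; rewrite -EFinD -EFinM lee_fin (le_trans _ (powR_add_le _ _ _))//.
  by apply: ge0_ler_powR; rewrite ?nnegrE ?(ltW p0) ?addr_ge0 ?ler_normD.
rewrite ge0_integralZl ?lee_fin ?powR_ge0//; last 2 first.
- by apply: emeasurable_funD; exact: mp.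
- by move=> w _; rewrite adde_ge0.
rewrite ge0_integralD//; [|exact: mp|exact: mp].
rewrite !powRM ?quasi_triangle_ge0 ?powR_ge0 ?addr_ge0//.
rewrite -powRrM mulVf ?gt_eqF// powRr1// -mulrA EFinM.
apply: lee_wpmul2l; first by rewrite lee_fin powR_ge0.
apply: le_trans (leeD fa gb) _; rewrite -EFinD lee_fin mulr_natl mulr2n.
apply: lerD; apply: ge0_ler_powR; rewrite ?nnegrE ?(ltW p0) ?addr_ge0//.
- by rewrite lerDl.
- by rewrite lerDr.
Qed.

Lemma pnorm_powR p t f a : 0 < p -> 0 < t ->
  (pnorm P (p * t) f <= a%:E)%E ->
  (pnorm P p (fun w => `|f w| `^ t)%R <= (a `^ t)%:E)%E.
Proof.
move=> p0 t0 fa; have a0 := pnorm_le_ge0 fa; have pt0 : 0 < p * t by rewrite mulr_gt0.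
move: fa => /(pnorm_le_moment pt0 a0) fa; apply/pnorm_leP; rewrite ?powR_ge0//.
under eq_integral do rewrite ger0_norm ?powR_ge0// -powRrM (mulrC t).
by rewrite -powRrM (mulrC t).
Qed.

(** The usual Hoelder inequality, applied to |f|^p and |g|^p with the conjugate
    exponents q / p and r / p. *)
Lemma hoelder_pnorm p q r f g a b : 0 < p -> 0 < q -> 0 < r ->
  p^-1 = q^-1 + r^-1 ->
  measurable_fun setT f -> measurable_fun setT g ->
  (pnorm P q f <= a%:E)%E -> (pnorm P r g <= b%:E)%E ->
  (pnorm P p (fun w => f w * g w)%R <= (a * b)%:E)%E.
Proof.
move=> p0 q0 r0 pqr mf mg fa gb.
have a0 := pnorm_le_ge0 fa; have b0 := pnorm_le_ge0 gb.
apply/pnorm_leP; rewrite ?mulr_ge0//.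
have qp0 : 0 < q / p by rewrite divr_gt0.
have rp0 : 0 < r / p by rewrite divr_gt0.
have := @hoelder _ _ _ P (fun w => `|f w| `^ p) (fun w => `|g w| `^ p) (q / p) (r / p)
  (measurable_powR_norm p mf) (measurable_powR_norm p mg) qp0 rp0.
rewrite !invf_div -mulrDr -pqr divff ?gt_eqF// => /(_ erefl).
rewrite Lnorm1.
under eq_integral do rewrite /= ger0_norm ?mulr_ge0 ?powR_ge0// -powRM// -normrM.
move=> /le_trans; apply; rewrite powRM// [leRHS]EFinM.
apply: lee_pmul; rewrite ?Lnorm_ge0//.
- apply: (@pnorm_powR (q / p) p) => //.
  by rewrite divfK ?gt_eqF.
- apply: (@pnorm_powR (r / p) p) => //.
  by rewrite divfK ?gt_eqF.
Qed.

(** Hoelder's inequality against the constant 1; this uses that P has mass 1. *)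
Lemma pnorm_le_exponent p q f a : 0 < p -> p <= q ->
  measurable_fun setT f ->
  (pnorm P q f <= a%:E)%E -> (pnorm P p f <= a%:E)%E.
Proof.
move=> p0; rewrite le_eqVlt => /predU1P[->//|pq] mf fa.
have q0 : 0 < q by exact: lt_trans pq.
have := @hoelder_pnorm p q (p^-1 - q^-1)^-1 f (fun=> 1) a 1.
rewrite mulr1; under [fun w => f w * 1]eq_fun do rewrite mulr1.
apply => //.
- by rewrite invr_gt0 subr_gt0 ltf_pV2 ?posrE.
- by rewrite invrK addrC subrK.
- rewrite (le_trans (pnorm_cst _ _)) ?normr1//.
  by rewrite invr_gt0 subr_gt0 ltf_pV2 ?posrE.
Qed.

(** Minkowski's inequality. The restriction to exponents at least 1 matters, since
    the bound must not depend on n. *)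
Lemma pnorm_average p (f : nat -> T -> R) n a : 1 <= p ->
  (forall i, measurable_fun setT (f i)) ->
  (forall i, pnorm P p (f i) <= a%:E)%E ->
  (0 < n)%N ->
  (pnorm P p (fun w => n%:R^-1 * \sum_(1 <= i < n.+1) f i w)%R <= a%:E)%E.
Proof.
move=> p1 mf fa n0; have p0 : 0 < p by exact: lt_le_trans p1.
have -> : a = n%:R^-1 * (n%:R * a) by rewrite mulKf// pnatr_eq0 -lt0n.
have ms m : measurable_fun setT (fun w => \sum_(1 <= i < m.+1) f i w).
  exact: measurable_sum.
apply: pnorm_scale => //; rewrite ?invr_ge0//.
elim: n {n0} => [|n IH].
  under eq_fun do rewrite big_nil; rewrite mul0r.
  by rewrite (le_trans (pnorm_cst _ _))// normr0.
under eq_fun do rewrite big_nat_recr//=.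
apply: (le_trans (minkowski_EFin P (ms n) (mf n.+1) p1)).
by rewrite -natr1 mulrDl mul1r EFinD; apply: leeD; [exact: IH | exact: fa].
Qed.

(** A finite expectation forces the positive and the negative part to have finite
    integrals, because an indeterminate difference of infinities is infinite by
    convention. *)
Lemma pnorm1_fin (f : T -> R) (N : R) : measurable_fun setT f ->
  ('E_P[f] = N%:E)%E -> exists e, (pnorm P 1 f <= e%:E)%E.
Proof.
rewrite unlock => mf; rewrite integralE.
have p0 : (0 <= \int[P]_x ((EFin \o f)^\+ x))%E by exact: integral_ge0.
have n0 : (0 <= \int[P]_x ((EFin \o f)^\- x))%E by exact: integral_ge0.
have mF : measurable_fun setT (EFin \o f) by exact/measurable_EFinP.
rewrite /pnorm Lnorm1.
have -> : (\int[P]_x `|(EFin \o f) x| =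
    \int[P]_x ((EFin \o f)^\+ x) + \int[P]_x ((EFin \o f)^\- x))%E.
  rewrite -ge0_integralD//; [|exact: measurable_funepos|exact: measurable_funeneg].
  apply: eq_integral => x _.
  by rewrite -[RHS]/(((EFin \o f)^\+ \+ (EFin \o f)^\-) x)%E -fune_abse.
case: (integral _ _ _) p0 => [a| |] //; case: (integral _ _ _) n0 => [b| |]//= _ _ _.
by exists (a + b).
Qed.

(** Stationarity for a single time: translating j by i - j turns the law of X j
    into that of X i, and a moment only depends on the law. *)
Lemma stationary_pnorm (d' : measure_display) (T' : measurableType d')
    (X : int -> T -> T') (phi : T' -> R) (p : R) (i j : int) :
  stationary P X -> (forall k, measurable_fun setT (X k)) ->
  measurable_fun setT phi ->
  pnorm P p (phi \o X i) = pnorm P p (phi \o X j).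
Proof.
move=> Xstat mX mphi; rewrite !pnormE; congr (_ `^ _)%E.
have law k : (\int[P]_w (`|(phi \o X k) w| `^ p)%:E =
    \int[pushforward P (X k)]_x (`|phi x| `^ p)%:E)%E.
  rewrite (ge0_integral_pushforward (mX k) P measurableT)//.
    apply/measurable_EFinP; apply: (measurableT_comp (measurable_powR p)) => //.
    exact: measurableT_comp.
rewrite !law; apply: eq_measure_integral => A mA _.
have mB : measurable ((@tnth 1 T' ^~ ord0) @^-1` A).
  by rewrite -[X in measurable X]setTI; exact: measurable_tnth.
have := Xstat 1%N [tuple j] (i - j) _ mB.
have coord h : [set w | ((@tnth 1 T' ^~ ord0) @^-1` A)
    [tuple X (tnth [tuple j] k + h) w | k < 1]] = X (j + h) @^-1` A.
  by apply/funext => w; rewrite /= tnth_mktuple (tnth_nth 0).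
rewrite coord addrC subrK /= /pushforward => ->; congr (P _).
by apply/funext => w; rewrite /= tnth_mktuple (tnth_nth 0).
Qed.

End pnorm_theory.

(** * The inverse of a random variable *)

Section measurable_inverse.
Context (d : measure_display) (T : measurableType d) (R : realType).

(** The inverse of x is x * (|x|^2)^-1, also at x = 0, and real powers are
    measurable. *)
Lemma measurable_fun_invr (f : T -> R) : measurable_fun setT f ->
  measurable_fun setT (fun w => (f w)^-1).
Proof.
move=> mf; rewrite (_ : (fun _ => _) = (fun w => f w * (`|f w| `^ 2) `^ (-1))); last first.
  apply/funext => w; rewrite powR_inv1 ?powR_ge0// powR_mulrn// real_normK ?num_real//.
  have [->|f0] := eqVneq (f w) 0; first by rewrite invr0 mul0r.
  by rewrite expr2; field.
apply: measurable_funM => //.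
by apply: (measurableT_comp (measurable_powR _)) => //; exact: measurable_powR_norm.
Qed.

End measurable_inverse.

(** * Weighted averages and their maximal bound *)

Section weighted_average.
Context (d : measure_display) (T : measurableType d) (R : realType).
Context (P : probability T R).

(** The l^s norm of the vector (V_1, ..., V_n), a majorant of the maximum of the
    |V_i| whose s-th power has an expectation that is a plain sum. *)
Definition lnorm_upto (s : R) (V : nat -> T -> R) n w : R :=
  (\sum_(1 <= i < n.+1) `|V i w| `^ s) `^ s^-1.

Lemma ler_lnorm_upto s (V : nat -> T -> R) n w i : 0 < s ->
  (0 < i <= n)%N -> `|V i w| <= lnorm_upto s V n w.
Proof.
move=> s0 /andP[i0 iln].
rewrite -[leLHS]powRr1// -(@divff _ s) ?gt_eqF// powRrM.
apply: ge0_ler_powR; rewrite ?invr_ge0 ?(ltW s0) ?nnegrE ?powR_ge0 ?sumr_ge0//.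
rewrite (big_cat_nat _ (n := i)) ?(leqW iln)//= [X in _ + X]big_ltn//=.
rewrite addrCA lerDl addr_ge0// sumr_ge0// => k _; exact: powR_ge0.
Qed.

(** The factor n^(1/s) is the price of bounding a maximum by a sum. *)
Lemma pnorm_lnorm_upto s (V : nat -> T -> R) n c : 0 < s ->
  (forall i, measurable_fun setT (V i)) ->
  (forall i, pnorm P s (V i) <= c%:E)%E ->
  (pnorm P s (lnorm_upto s V n) <= (n%:R `^ s^-1 * c)%:E)%E.
Proof.
move=> s0 mV Vc; have c0 := pnorm_le_ge0 (Vc 0%N).
apply/pnorm_leP; rewrite ?mulr_ge0 ?powR_ge0//.
rewrite powRM ?powR_ge0// -powRrM mulVf ?gt_eqF// powRr1//.
under eq_integral.
  move=> w _; rewrite ger0_norm ?powR_ge0// /lnorm_upto -powRrM mulVf ?gt_eqF//.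
  rewrite powRr1 ?sumr_ge0// -sumEFin. over.
rewrite ge0_integral_sum//; last by move=> i; exact: measurable_moment.
rewrite mulr_natl -[X in (_ *+ X)%R](subn1 n.+1) -sumr_const_nat -sumEFin.
by apply: lee_sum => i _; exact: pnorm_le_moment.
Qed.

Lemma weighted_average_le (u v : nat -> R) M n :
  (forall i, 0 <= u i) -> (forall i, (0 < i <= n)%N -> `|v i| <= M) ->
  `|n%:R^-1 * \sum_(1 <= i < n.+1) (u i * v i)|
    <= M * (n%:R^-1 * \sum_(1 <= i < n.+1) u i).
Proof.
move=> u0 vM; rewrite mulrCA normrM ger0_norm ?invr_ge0// ler_wpM2l ?invr_ge0//.
rewrite mulr_sumr (le_trans (ler_norm_sum _ _ _))//.
rewrite big_nat_cond [leRHS]big_nat_cond; apply: ler_sum => i; rewrite andbT ltnS => iln.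
by rewrite normrM (ger0_norm (u0 i)) mulrC ler_wpM2r// vM.
Qed.

End weighted_average.

(** * The pointwise bound of the ratio *)

(** Deterministic heart of the proof: M is an a priori bound of the ratio, used
    only where d0 is at distance more than D / 2 from D. The parameter t is free,
    to be tuned to the exponents of Hoelder's inequality. *)
Lemma ratio_bound (R : realType) (nh d0 D N M t : R) : 0 < D -> 0 <= d0 -> 0 <= t ->
  `|nh| <= M * d0 -> 0 <= M ->
  `|nh / d0 - N / D| <= D^-1 * `|nh - N| + (2 / D ^+ 2 * (`|nh| * `|d0 - D|) +
     D^-1 * (2 / D) `^ t * (M * `|d0 - D| `^ (1 + t))).
Proof.
move=> D0 d00 t0 nhM M0; have Dn0 : D != 0 by rewrite gt_eqF.
(* If d0 = 0, the assumption nh <= M * d0 in absolute value forces nh = 0. *)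
have R1 : nh = nh / d0 * d0.
  have [d0E|dn] := eqVneq d0 0; last by rewrite divfK.
  by apply/eqP; rewrite d0E mulr0 -normr_le0 (le_trans nhM)// d0E mulr0.
have RM : `|nh / d0| <= M.
  rewrite normrM normfV (ger0_norm d00).
  have [->|dn] := eqVneq d0 0; first by rewrite invr0 mulr0.
  by rewrite ler_pdivrMr// lt_neqAle eq_sym dn.
set rh := nh / d0 in R1 RM *; clearbody rh.
have -> : rh - N / D = D^-1 * (nh - N) - D^-1 * (rh * (d0 - D)).
  by rewrite [in RHS]R1; field.
apply: (le_trans (ler_normB _ _)); rewrite !normrM gtr0_norm ?invr_gt0//.
rewrite lerD2l.
have x0 := normr_ge0 (d0 - D).
set x := `|d0 - D| in x0 *.
have [xD|xD] := leP x (D / 2).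
  apply: (@le_trans _ _ (2 / D ^+ 2 * (`|nh| * x))); last first.
    by rewrite lerDl !mulr_ge0 ?powR_ge0 ?invr_ge0 ?(ltW D0).
  have -> : 2 / D ^+ 2 * (`|nh| * x) = D^-1 * ((2 / D * `|nh|) * x) by field.
  rewrite ler_wpM2l ?invr_ge0 ?(ltW D0)// ler_wpM2r//.
  rewrite [in leRHS]R1 normrM (ger0_norm d00).
  have dD : D / 2 <= d0.
    by move: xD; rewrite /x ler_norml => /andP[+ _]; lra.
  rewrite mulrCA ler_peMr// mulrAC ler_pdivlMr// mul1r; lra.
(* Here (2 / D) * x > 1, so multiplying M * x by its t-th power is harmless. *)
apply: (@le_trans _ _ (D^-1 * (2 / D) `^ t * (M * x `^ (1 + t)))); last first.
  by rewrite lerDr !mulr_ge0 ?invr_ge0 ?exprn_ge0 ?(ltW D0).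
rewrite -mulrA ler_wpM2l ?invr_ge0 ?(ltW D0)//.
have xp : 0 < x by apply: lt_trans xD; rewrite divr_gt0.
rewrite powRD ?(gt_eqF xp) ?implybT// powRr1//.
rewrite (_ : _ * (M * _) = M * x * ((2 / D) `^ t * x `^ t)); last by ring.
rewrite -powRM ?divr_ge0 ?(ltW D0)//.
apply: (@le_trans _ _ (M * x)); first by rewrite ler_wpM2r.
rewrite ler_peMr ?mulr_ge0// -[leLHS](powRr0 (2 / D * x)); apply: ler_powR => //.
by rewrite mulrAC ler_pdivlMr// mul1r; lra.
Qed.

(** * Application to the ratio estimator *)

Section ratio_estimator.
Context (d : measure_display) (T : measurableType d) (R : realType).
Context (P : probability T R) (U V : int -> {RV P >-> R}).

Let mU i : measurable_fun setT (U i). Proof. exact: measurable_funPT. Qed.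
Let mV i : measurable_fun setT (V i). Proof. exact: measurable_funPT. Qed.
Let mUV i : measurable_fun setT (fun w => U i w * V i w).
Proof. exact: measurable_funM. Qed.

Lemma measurable_Dhat n : measurable_fun setT (Dhat U n).
Proof. by apply: measurable_funM => //; exact: measurable_sum. Qed.

Lemma measurable_Nhat n : measurable_fun setT (Nhat U V n).
Proof. by apply: measurable_funM => //; exact: measurable_sum. Qed.

Lemma measurable_Rhat n : measurable_fun setT (Rhat U V n).
Proof.
apply: measurable_funM; first exact: measurable_Nhat.
by apply: measurable_fun_invr; exact: measurable_Dhat.
Qed.

(** For r >= 1 this is Minkowski's inequality. For r < 1 the moment of order r is
    at most the one of order 1, to which Minkowski's inequality applies; all the
    products U_i V_i have the first absolute moment of U_1 V_1 by stationarity. *)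
Lemma Nhat_bounded (N r c : R) :
  stationary P (fun (i : int) (w : T) => (U i w, V i w)) ->
  ('E_P[fun w : T => (U 1%:Z w * V 1%:Z w)%R] = N%:E)%E ->
  0 < r ->
  (forall i, pnorm P r (fun w => (U i w * V i w)%R) <= c%:E)%E ->
  exists B, forall n, (0 < n)%N -> (pnorm P r (Nhat U V n) <= B%:E)%E.
Proof.
move=> UVstat EUV r0 UVc; have [r1|r1] := leP 1 r.
  by exists c => n n0; apply: pnorm_average.
have [e UVe] := pnorm1_fin (mUV 1) EUV; exists e => n n0.
apply: (@pnorm_le_exponent _ _ _ P r 1) => //; [exact: ltW|exact: measurable_Nhat|].
apply: pnorm_average => // i.
have mX k : measurable_fun setT (fun w => (U k w, V k w)).
  exact: measurable_fun_pair.
have mM : measurable_fun setT (fun x : R * R => x.1 * x.2).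
  by apply: measurable_funM.
by rewrite (le_trans _ UVe)// (stationary_pnorm 1 i 1 UVstat mX mM).
Qed.

Lemma Rhat_sub_le (D N s t : R) n : 0 < D -> 0 < s -> 0 <= t ->
  (forall i : int, {ae P, forall w : T, 0 <= U i w}) ->
  {ae P, forall w, `|Rhat U V n w - N / D| <=
    D^-1 * `|Nhat U V n w - N| +
    (2 / D ^+ 2 * (`|Nhat U V n w| * `|Dhat U n w - D|) +
     D^-1 * (2 / D) `^ t *
       (lnorm_upto s (fun i => V i%:Z) n w * `|Dhat U n w - D| `^ (1 + t)))}.
Proof.
move=> D0 s0 t0 U0; have := ae_foralln (fun i : nat => U0 i%:Z).
apply: filterS => w Uw; apply: ratio_bound => //.
- by rewrite mulr_ge0 ?invr_ge0// sumr_ge0.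
- by apply: weighted_average_le => // i ?; exact: (ler_lnorm_upto (fun i : nat => V i%:Z)).
- exact: powR_ge0.
Qed.

End ratio_estimator.

Theorem theorem1 (d : measure_display) (T : measurableType d) (R : realType)
    (P : probability T R) (U V : int -> {RV P >-> R})
    (p q c C D N : R)
    (hstat : stationary P (fun (i : int) (w : T) => (U i w, V i w)))
    (hU : forall i : int, {ae P, forall w : T, 0 <= U i w})
    (hD : ('E_P[U 1%:Z] = D%:E)%E)
    (hD0 : 0 < D)
    (hN : ('E_P[fun w : T => (U 1%:Z w * V 1%:Z w)%R] = N%:E)%E)
    (hp : 0 < p)
    (hpq : p < q)
    (hr : forall i : int,
        (pnorm P (p * q / (q - p))%R (fun w : T => (U i w * V i w)%R)
         <= c%:E)%E)
    (hs : forall i : int,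
        (pnorm P (p * (q + 2) / (q - p))%R (V i) <= c%:E)%E)
    (hDhat : forall n : nat, (0 < n)%N ->
        (pnorm P q (fun w : T => (Dhat U n w - D)%R)
         <= (C * n%:R `^ (- 2^-1))%:E)%E)
    (hNhat : forall n : nat, (0 < n)%N ->
        (pnorm P p (fun w : T => (Nhat U V n w - N)%R)
         <= (C * n%:R `^ (- 2^-1))%:E)%E) :
  (\forall n \near \oo,
     (pnorm P p (fun w : T => (Rhat U V n w - N / D)%R) < +oo)%E) /\
  (fun n : nat => fine (pnorm P p (fun w : T => (Rhat U V n w - N / D)%R)))
    =O_\oo (fun n : nat => n%:R `^ (- 2^-1) : R).
Proof.
have q0 : 0 < q by exact: lt_trans hpq.
have qp : 0 < q - p by rewrite subr_gt0.
have pn0 : p != 0 by rewrite gt_eqF.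
have qn0 : q != 0 by rewrite gt_eqF.
have qpn0 : q - p != 0 by rewrite gt_eqF.
have q20 : 0 < q + 2 by rewrite addr_gt0.
have q2n0 : q + 2 != 0 by rewrite gt_eqF.
set r := p * q / (q - p) in hr; set s := p * (q + 2) / (q - p) in hs.
have r0 : 0 < r by rewrite divr_gt0 // mulr_gt0.
have s0 : 0 < s by rewrite divr_gt0 // mulr_gt0.
(* The value of s is the one for which t = 2 / s satisfies both the Hoelder
   relation sqE and the balance of powers of n in vE. *)
pose t := 2 / s; have t0 : 0 <= t by rewrite divr_ge0 // ltW.
have t1 : 0 < 1 + t by rewrite (lt_le_trans ltr01)// lerDl.
have rqE : p^-1 = r^-1 + q^-1 by rewrite /r; field; rewrite qn0 qpn0.
have sqE : p^-1 = s^-1 + (q / (1 + t))^-1.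
  by rewrite invf_div /t /s; field; rewrite qpn0 q2n0 pn0 qn0 gt_eqF// addr_gt0 ?mulr_gt0.
have C0 : 0 <= C.
  by have := pnorm_le_ge0 (hNhat 1%N isT); rewrite powR1 mulr1.
have [B NB] := Nhat_bounded hstat hN r0 hr.
pose K := quasi_triangle p.
pose A := K * (D^-1 * C + K * (2 / D ^+ 2 * (B * C) +
  D^-1 * (2 / D) `^ t * (c * C `^ (1 + t)))).
have main n : (0 < n)%N ->
    (pnorm P p (fun w => (Rhat U V n w - N / D)%R) <= (A * n%:R `^ (- 2^-1))%:E)%E.
  move=> n0; set v := n%:R `^ (- 2^-1).
  have nr0 : 0 < n%:R :> R by rewrite ltr0n.
  (* The growth n^(1/s) of the maximal bound is absorbed: t / 2 = 1 / s. *)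
  have vE : n%:R `^ s^-1 * v `^ (1 + t) = v.
    rewrite powRD ?(gt_eqF (powR_gt0 _ _))// ?implybT// powRr1 ?powR_ge0//.
    rewrite mulrCA -[v `^ t]powRrM (_ : - 2^-1 * t = - s^-1); last first.
      by rewrite /t; field; rewrite gt_eqF.
    by rewrite powRN divff ?mulr1// gt_eqF ?powR_gt0.
  have mN := measurable_Nhat U V n; have mD := measurable_Dhat U n.
  have mNN : measurable_fun setT (fun w => Nhat U V n w - N) by exact: measurable_funB.
  have mDD : measurable_fun setT (fun w => Dhat U n w - D) by exact: measurable_funB.
  have mM : measurable_fun setT (lnorm_upto s (fun i => V i%:Z) n).
    apply: (measurableT_comp (measurable_powR _)) => //.
    by apply: measurable_sum => i; exact: measurable_powR_norm.
  have mDt := measurable_powR_norm (1 + t) mDD.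
  have b1 : (pnorm P p (fun w => `|Nhat U V n w - N|%R) <= (C * v)%:E)%E.
    by rewrite pnorm_normr; exact: hNhat.
  have b2 : (pnorm P p (fun w => (`|Nhat U V n w| * `|Dhat U n w - D|)%R) <=
      (B * (C * v))%:E)%E.
    apply: (hoelder_pnorm hp r0 q0 rqE); try exact: measurableT_comp.
    - by rewrite pnorm_normr; exact: NB.
    - by rewrite pnorm_normr; exact: hDhat.
  have b3 : (pnorm P p (fun w =>
      (lnorm_upto s (fun i => V i%:Z) n w * `|Dhat U n w - D| `^ (1 + t))%R)
      <= (n%:R `^ s^-1 * c * (C * v) `^ (1 + t))%:E)%E.
    apply: (hoelder_pnorm hp s0 _ sqE) => //; first by rewrite divr_gt0.
    - exact: pnorm_lnorm_upto.
    - by apply: pnorm_powR; rewrite ?divr_gt0// divfK ?gt_eqF//; exact: hDhat.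
  have mb1 : measurable_fun setT (fun w => `|Nhat U V n w - N|) by exact: measurableT_comp.
  have mb2 : measurable_fun setT (fun w => `|Nhat U V n w| * `|Dhat U n w - D|).
    by apply: measurable_funM; exact: measurableT_comp.
  have mb3 := measurable_funM mM mDt.
  have D1 : 0 <= D^-1 by rewrite invr_ge0 ltW.
  have D2 : 0 <= 2 / D ^+ 2 by rewrite divr_ge0 ?exprn_ge0 ?(ltW hD0).
  have D3 : 0 <= D^-1 * (2 / D) `^ t by rewrite mulr_ge0 ?powR_ge0.
  have scaleM (k : R) (f : T -> R) : measurable_fun setT f ->
      measurable_fun setT (fun w => k * f w).
    by move=> mf; exact: measurable_funM.
  have := pnorm_add hp (scaleM _ _ mb1) (measurable_funD (scaleM _ _ mb2) (scaleM _ _ mb3))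
    (pnorm_scale hp mb1 D1 b1)
    (pnorm_add hp (scaleM _ _ mb2) (scaleM _ _ mb3)
      (pnorm_scale hp mb2 D2 b2) (pnorm_scale hp mb3 D3 b3)).
  have -> : quasi_triangle p * (D^-1 * (C * v) +
      quasi_triangle p * (2 / D ^+ 2 * (B * (C * v)) +
      D^-1 * (2 / D) `^ t * (n%:R `^ s^-1 * c * (C * v) `^ (1 + t)))) = A * v.
    rewrite powRM ?powR_ge0//.
    rewrite (_ : n%:R `^ s^-1 * c * _ =
      c * C `^ (1 + t) * (n%:R `^ s^-1 * v `^ (1 + t))); last by ring.
    by rewrite vE /A /K; ring.
  apply: le_pnorm => //.
  - by apply: measurable_funB => //; exact: measurable_Rhat.
  - apply: measurable_funD; first exact: scaleM.
    by apply: measurable_funD; exact: scaleM.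
  have := @Rhat_sub_le _ _ _ P U V D N s t n hD0 s0 t0 hU.
  by apply: filterS => w /le_trans; apply; exact: ler_norm.
split.
  exists 1%N => // n /= n0; exact: le_lt_trans (main n n0) (ltry _).
apply/eqOP; near=> k; exists 1%N => // n /= n0.
have := main n n0; set x := pnorm _ _ _.
have x0 : (0 <= x)%E by exact: Lnorm_ge0.
rewrite ger0_norm ?fine_ge0// ger0_norm ?powR_ge0//.
case: x x0 => //= x x0; rewrite lee_fin => /le_trans; apply.
by rewrite ler_wpM2r ?powR_ge0//; near: k; exact: nbhs_pinfty_ge.
Unshelve. all: by end_near.
Qed.
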